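(* Let $\mathcal{I}_{Lip}^{1},\mathcal{I}_{Lip}^{2}$ be normed Lipschitz operator ideals, $X_1,X_2$ pointed metric spaces and $E$ a Banach space. Then $BLip(\mathcal{I}_{Lip}^{1},\mathcal{I}_{Lip}^{2})(X_1,X_2;E)$ is a linear subspace of $BLip_0(X_1,X_2;E)$ and $\|\cdot\|_{BLip(\mathcal{I}_{Lip}^{1},\mathcal{I}_{Lip}^{2})}$ is a quasi-norm on $BLip(\mathcal{I}_{Lip}^{1},\mathcal{I}_{Lip}^{2})(X_1,X_2;E)$.
   Context: Let $\mathbb{K}$ be $\mathbb{R}$ or $\mathbb{C}$; all Banach spaces are over $\mathbb{K}$. A pointed metric space is a metric space with a distinguished base point $0$; a Banach space is a pointed metric space with base point the null vector. $Lip_0(X,Y)$ is the set of Lipschitz maps $T:X\to Y$ with $T(0)=0$ and $Lip(T)$ is the least Lipschitz constant; $X^{\#}=Lip_0(X,\mathbb{K})$. $\mathcal{L}(E,F)$ is the space of bounded linear operators. A map $T:X_1\times X_2\to E$ belongs to $BLip_0(X_1,X_2;E)$ if $T(x_1,0)=T(0,x_2)=0$ for all $x_1,x_2$ and there is $C>0$ with $\|T(x_1,x_2)-T(x_1,x_2')-T(x_1',x_2)+T(x_1',x_2')\|\le C\,d(x_1,x_1')d(x_2,x_2')$ for all $x_1,x_1'\in X_1$, $x_2,x_2'\in X_2$. The least such $C$ is the norm $BLip(T)$. A Lipschitz operator ideal $\mathcal{I}_{Lip}$ is a subclass of $Lip_0$ such that for every pointed metric space $X$ and Banach space $E$ the components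 $\mathcal{I}_{Lip}(X,E):=Lip_0(X,E)\cap\mathcal{I}_{Lip}$ satisfy: (i) $\mathcal{I}_{Lip}(X,E)$ is a linear subspace of $Lip_0(X,E)$; (ii) $vg:x\mapsto g(x)v$ belongs to $\mathcal{I}_{Lip}(X,E)$ for $v\in E$, $g\in X^{\#}$; (iii) if $S\in Lip_0(Y,X)$, $T\in\mathcal{I}_{Lip}(X,E)$, $w\in\mathcal{L}(E,F)$, then $wTS\in\mathcal{I}_{Lip}(Y,F)$. It is normed if there is $\|\cdot\|_{\mathcal{I}_{Lip}}:\mathcal{I}_{Lip}\to[0,\infty)$ such that each $(\mathcal{I}_{Lip}(X,E),\|\cdot\|_{\mathcal{I}_{Lip}})$ is a normed space with $Lip(T)\le\|T\|_{\mathcal{I}_{Lip}}$; $\|Id_{\mathbb{K}}\|_{\mathcal{I}_{Lip}}=1$; and $\|wTS\|_{\mathcal{I}_{Lip}}\le Lip(S)\|T\|_{\mathcal{I}_{Lip}}\|w\|$. Factorization method: $T\in BLip_0(X_1,X_2;E)$ belongs to $BLip(\mathcal{I}_{Lip}^{1},\mathcal{I}_{Lip}^{2})(X_1,X_2;E)$ iff there are Banach spaces $G_1,G_2$, $f_j\in\mathcal{I}_{Lip}^{j}(X_j,G_j)$ ($j=1,2$) and $R\in BLip_0(G_1,G_2;E)$ with $T=R\circ(f_1,f_2)$; and $\|T\|_{BLip(\mathcal{I}_{Lip}^{1},\mathcal{I}_{Lip}^{2})}=\inf BLip(R)\|f_1\|_{\mathcal{I}_{Lip}^{1}}\|f_2\|_{\mathcal{I}_{Lip}^{2}}$,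 the infimum over all such factorizations. *)

(* Defs.v *)
From HB Require Import structures.
From mathcomp Require Import all_boot all_order all_algebra.
From mathcomp Require Import complex.
From mathcomp Require Import all_classical all_reals all_analysis.
Import Order.TTheory GRing.Theory Num.Theory.
Import numFieldNormedType.Exports.

Set Implicit Arguments.
Unset Strict Implicit.
Unset Printing Implicit Defensive.

Local Open Scope classical_set_scope.
Local Open Scope ring_scope.

(* The scalar field is R or C = R[i].  In MathComp-Analysis the norm of a
   normed module over K takes its values in K; [rnorm] is the corresponding
   real number, so that all distances, constants and norms below live in R. *)
Inductive scalar_kind := RealScalars | ComplexScalars.

Definition scalars (R : realType) (k : scalar_kind) : numFieldType :=
  match k with
  | RealScalars => R
  | ComplexScalars => R[i]
  end.

Definition real_part (R : realType) (k : scalar_kind) : scalars R k -> R :=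
  match k with
  | RealScalars => id
  | ComplexScalars => @complex.Re R
  end.

Definition rnorm (R : realType) (k : scalar_kind)
    (V : normedZmodType (scalars R k)) (x : V) : R := real_part `|x|.

Section rnorm_theory.
Variables (R : realType) (k : scalar_kind).
Implicit Types a b : scalars R k.

Lemma real_partD a b : real_part (a + b) = real_part a + real_part b.
Proof. by case: k a b => //= -[? ?] [? ?]. Qed.

Lemma real_part_le a b : a <= b -> real_part a <= real_part b.
Proof.
by case: k a b => //= -[ar ai] [br bi]; rewrite lecE => /andP[].
Qed.

Lemma real_part_eq0 a : 0 <= a -> real_part a = 0 -> a = 0.
Proof.
case: k a => //= -[ar ai]; rewrite lecE/= => /andP[/eqP ai0 _] ->.
by rewrite ai0.
Qed.

Variable V : normedZmodType (scalars R k).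
Implicit Types x y z : V.

Lemma rnorm0 : rnorm (0 : V) = 0.
Proof. by rewrite /rnorm normr0; case: k. Qed.

Lemma rnorm0_eq0 x : rnorm x = 0 -> x = 0.
Proof. by move=> /(real_part_eq0 (normr_ge0 x))/normr0_eq0. Qed.

Lemma rnormD x y : rnorm (x + y) <= rnorm x + rnorm y.
Proof. by rewrite /rnorm -real_partD real_part_le// ler_normD. Qed.

Lemma rdistxx x : rnorm (x - x) = 0.
Proof. by rewrite subrr rnorm0. Qed.

Lemma rdist_positivity x y : rnorm (x - y) = 0 -> x = y.
Proof. by move=> /rnorm0_eq0/eqP; rewrite subr_eq0 => /eqP. Qed.

Lemma rdist_sym x y : rnorm (x - y) = rnorm (y - x).
Proof. by rewrite /rnorm distrC. Qed.

Lemma rdist_triangle y x z : rnorm (x - z) <= rnorm (x - y) + rnorm (y - z).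
Proof. by rewrite -(subrKA y) rnormD. Qed.

End rnorm_theory.

Lemma complex_complete (R : realType) (F : set_system (R[i])^o) :
  ProperFilter F -> cauchy F -> cvg F.
Proof.
move=> FF /cauchy_ballP FC.
have part (p : R[i] -> R) :
    (forall z w, p (z - w) = p z - p w) -> (forall z, `|p z| <= complex.Re `|z|) ->
    cvg (p @ F).
  move=> pB ple; apply: cauchy_cvg; apply/cauchy_ballP => e e0.
  have eC0 : (0 : R[i]) < e%:C%C by rewrite ltcR.
  have := FC _ eC0; rewrite !near_simpl /=.
  move=> [[A B] /= [FA FB] AB].
  exists (p @` A, p @` B) => /=.
    by split; [apply: filterS FA|apply: filterS FB] => z ? /=; exists z.
  move=> [_ _] /= [[z Az <-] [w Bw <-]].
  have := AB (z, w) (conj Az Bw); rewrite /ball /= => zw.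
  rewrite -pB; apply: (le_lt_trans (ple _)).
  by move: zw; rewrite ltcE => /andP[].
have ReB z w : complex.Re (z - w) = complex.Re z - complex.Re w :> R.
  by case: z w => [? ?] [? ?].
have ImB z w : complex.Im (z - w) = complex.Im z - complex.Im w :> R.
  by case: z w => [? ?] [? ?].
have Re_le (z : R[i]) : `|complex.Re z| <= complex.Re `|z|.
  by rewrite normc_def /= -sqrtr_sqr ler_wsqrtr// lerDl sqr_ge0.
have Im_le (z : R[i]) : `|complex.Im z| <= complex.Re `|z|.
  by rewrite normc_def /= -sqrtr_sqr ler_wsqrtr// lerDr sqr_ge0.
have le_ReIm (z : R[i]) :
    complex.Re `|z| <= `|complex.Re z| + `|complex.Im z|.
  rewrite normc_def /= -[leRHS]ger0_norm// -[leRHS]sqrtr_sqr ler_wsqrtr//.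
  by rewrite sqrrD !real_normK ?num_real// lerD2r lerDl mulrn_wge0// mulr_ge0.
have small (z : R[i]) (e : R) :
    `|complex.Re z| + `|complex.Im z| < e -> `|z| < (e +i* 0)%C.
  by move=> ze; rewrite ltcE /= (le_lt_trans (le_ReIm z) ze) andbT.
have /cvg_ex[a /cvgrPdist_lt aP] := part _ ReB Re_le.
have /cvg_ex[b /cvgrPdist_lt bP] := part _ ImB Im_le.
apply/cvg_ex; exists (a +i* b)%C; apply/cvg_ballP => -[e ei].
rewrite ltcE/= => /andP[/eqP -> e0].
have e20 : 0 < e / 2 by rewrite divr_gt0.
near=> z.
apply: small; rewrite ReB ImB/= [ltRHS]splitr ltrD//; near: z.
- exact: aP.
- exact: bP.
Unshelve. all: by end_near. Qed.

(* K as a Banach space over itself; an alias of K^o, whose completeness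
   instance in the library is tied to K : realType. *)
Definition scalar_space (R : realType) (k : scalar_kind) : Type :=
  (scalars R k)^o.

HB.instance Definition _ (R : realType) (k : scalar_kind) :=
  NormedModule.copy (scalar_space R k) (scalars R k)^o.

Lemma scalar_space_complete (R : realType) (k : scalar_kind)
    (F : set_system (scalar_space R k)) :
  ProperFilter F -> cauchy F -> cvg F.
Proof.
case: k F => F.
- exact: (@R_complete R).
- exact: complex_complete.
Qed.

HB.instance Definition _ (R : realType) (k : scalar_kind) :=
  Uniform_isComplete.Build (scalar_space R k) (@scalar_space_complete R k).

#[short(type="pointedMetricType")]
HB.structure Definition PointedMetric (R : numDomainType) :=
  {M of Metric R M & isPointed M}.

(* A Banach space seen as a pointed metric space: real-valued distance
   |x - y| and base point 0. *)
Definition banach_metric (R : realType) (k : scalar_kind)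
  (E : completeNormedModType (scalars R k)) : Type := E.

HB.instance Definition _ (R : realType) (k : scalar_kind)
    (E : completeNormedModType (scalars R k)) :=
  Choice.on (banach_metric E).

HB.instance Definition _ (R : realType) (k : scalar_kind)
    (E : completeNormedModType (scalars R k)) :=
  isMetric.Build R (banach_metric E) (@rdistxx R k E)
    (@rdist_positivity R k E) (@rdist_sym R k E) (@rdist_triangle R k E).

HB.instance Definition _ (R : realType) (k : scalar_kind)
    (E : completeNormedModType (scalars R k)) :=
  isPointed.Build (banach_metric E) (0 : E).

Definition lip_bound (R : realType) (X Y : pointedMetricType R)
    (T : X -> Y) (C : R) : Prop :=
  0 <= C /\ forall x x', mdist (T x) (T x') <= C * mdist x x'.

Definition Lip0 (R : realType) (X Y : pointedMetricType R) : set (X -> Y) :=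
  [set T | (exists C, lip_bound T C) /\ T point = point].

Arguments Lip0 {R} X Y.

Definition Lip (R : realType) (X Y : pointedMetricType R) (T : X -> Y) : R :=
  inf [set C | lip_bound T C].

Section vector_space_notions.
Variables (R : realType) (k : scalar_kind) (V : lmodType (scalars R k)).

(* A is a linear subspace of the space of maps B. *)
Definition linear_subspace (B A : set V) : Prop :=
  [/\ A `<=` B, A 0 &
      forall (a : scalars R k) u v, A u -> A v -> A (a *: u + v)].

Definition norm_with_constant (C : R) (A : set V) (N : V -> R) : Prop :=
  [/\ forall u, A u -> 0 <= N u,
      forall u, A u -> (N u = 0 <-> u = 0),
      forall (a : scalars R k) u, A u -> N (a *: u) = real_part `|a| * N u &
      forall u v, A u -> A v -> N (u + v) <= C * (N u + N v)].

Definition is_norm (A : set V) (N : V -> R) : Prop := norm_with_constant 1 A N.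

Definition is_quasi_norm (A : set V) (N : V -> R) : Prop :=
  exists C : R, 1 <= C /\ norm_with_constant C A N.

End vector_space_notions.

Section ideals.
Variables (R : realType) (k : scalar_kind).
Local Notation K := (scalars R k).

Definition op_bound (E F : completeNormedModType K) (w : E -> F) (C : R) : Prop :=
  0 <= C /\ forall x, rnorm (w x) <= C * rnorm x.

Definition bounded_op (E F : completeNormedModType K) (w : {linear E -> F}) :=
  exists C, op_bound w C.

Definition op_norm (E F : completeNormedModType K) (w : E -> F) : R :=
  inf [set C | op_bound w C].

Definition blip_bound (X1 X2 : pointedMetricType R) (E : completeNormedModType K)
    (T : X1 * X2 -> E) (C : R) : Prop :=
  0 < C /\ forall (x1 x1' : X1) (x2 x2' : X2),
    rnorm (T (x1, x2) - T (x1, x2') - T (x1', x2) + T (x1', x2'))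
      <= C * mdist x1 x1' * mdist x2 x2'.

Definition BLip0 (X1 X2 : pointedMetricType R) (E : completeNormedModType K) :
    set (X1 * X2 -> E) :=
  [set T | [/\ forall x1, T (x1, point) = 0, forall x2, T (point, x2) = 0 &
               exists C, blip_bound T C]].

Arguments BLip0 : clear implicits.

Definition BLip (X1 X2 : pointedMetricType R) (E : completeNormedModType K)
    (T : X1 * X2 -> E) : R :=
  inf [set C | blip_bound T C].

(* The class of maps is given by its components I(X, E). *)
Record lipschitz_ideal := LipschitzIdeal {
  ideal_set : forall (X : pointedMetricType R) (E : completeNormedModType K),
    set (X -> E);
  ideal_subspace : forall (X : pointedMetricType R) (E : completeNormedModType K),
    linear_subspace (Lip0 X (banach_metric E)) (@ideal_set X E);
  ideal_rank_one : forall (X : pointedMetricType R) (E : completeNormedModType K)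
      (v : E) (g : X -> scalar_space R k),
    Lip0 X (banach_metric (scalar_space R k)) g ->
    @ideal_set X E (fun x => (g x : K) *: v);
  ideal_comp : forall (X Y : pointedMetricType R) (E F : completeNormedModType K)
      (S : Y -> X) (T : X -> E) (w : {linear E -> F}),
    Lip0 Y X S -> @ideal_set X E T -> bounded_op w ->
    @ideal_set Y F (w \o T \o S)
}.

Arguments ideal_set : clear implicits.

(* The norm is only constrained on members of the ideal. *)
Record normed_lipschitz_ideal := NormedLipschitzIdeal {
  nideal :> lipschitz_ideal;
  ideal_norm : forall (X : pointedMetricType R) (E : completeNormedModType K),
    (X -> E) -> R;
  ideal_norm_norm : forall (X : pointedMetricType R) (E : completeNormedModType K),
    is_norm (ideal_set nideal X E) (@ideal_norm X E);
  Lip_le_ideal_norm : forall (X : pointedMetricType R)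
      (E : completeNormedModType K) (T : X -> E),
    ideal_set nideal X E T -> @Lip R X (banach_metric E) T <= @ideal_norm X E T;
  ideal_norm_id :
    @ideal_norm (banach_metric (scalar_space R k)) (scalar_space R k) id = 1;
  ideal_norm_comp : forall (X Y : pointedMetricType R)
      (E F : completeNormedModType K)
      (S : Y -> X) (T : X -> E) (w : {linear E -> F}),
    Lip0 Y X S -> ideal_set nideal X E T -> bounded_op w ->
    @ideal_norm Y F (w \o T \o S) <= Lip S * @ideal_norm X E T * op_norm w
}.

Section factorization.
Variables (I1 I2 : normed_lipschitz_ideal).
Variables (X1 X2 : pointedMetricType R) (E : completeNormedModType K).

Definition factorization (T : X1 * X2 -> E) (G1 G2 : completeNormedModType K)
    (f1 : X1 -> G1) (f2 : X2 -> G2)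
    (A : banach_metric G1 * banach_metric G2 -> E) : Prop :=
  [/\ ideal_set I1 X1 G1 f1, ideal_set I2 X2 G2 f2,
      BLip0 (banach_metric G1) (banach_metric G2) E A &
      T = (fun x => A (f1 x.1, f2 x.2))].

Definition BLip_ideal : set (X1 * X2 -> E) :=
  [set T | BLip0 X1 X2 E T /\
    exists (G1 G2 : completeNormedModType K) (f1 : X1 -> G1) (f2 : X2 -> G2)
      (A : banach_metric G1 * banach_metric G2 -> E), factorization T f1 f2 A].

Definition BLip_ideal_norm (T : X1 * X2 -> E) : R :=
  inf [set r | exists (G1 G2 : completeNormedModType K)
      (f1 : X1 -> G1) (f2 : X2 -> G2)
      (A : banach_metric G1 * banach_metric G2 -> E),
    factorization T f1 f2 A /\
    r = BLip A * ideal_norm I1 f1 * ideal_norm I2 f2].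

End factorization.
End ideals.

Arguments BLip0 {R k} X1 X2 E.
Arguments BLip_ideal {R k} I1 I2 X1 X2 E.
Arguments BLip_ideal_norm {R k} I1 I2 X1 X2 E.

(* Main.v *)
Require Import Defs.
From HB Require Import structures.
From mathcomp Require Import all_boot all_order all_algebra.
From mathcomp Require Import complex.
From mathcomp Require Import all_classical all_reals all_analysis.
From mathcomp Require Import ring lra.
Import Order.TTheory GRing.Theory Num.Theory.
Import numFieldNormedType.Exports.

(** The proof rests on one normalization.  Given a factorization
    T = A o (f1, f2) with f1, f2 nonzero, the positive scalars ||f1|| and
    ||f2|| can be moved from the f_j into A, which multiplies BLip(A) by
    ||f1|| ||f2||.  Hence, for every r larger than the factorization quasi-norm
    N(T), T factors as A o (f1, f2) with ||f1||, ||f2|| <= 1 and r an admissible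
    constant for A ([unit_factorization_norm_lt]); conversely such a unit
    factorization with constant r puts T in the class and gives N(T) <= r
    ([unit_factorization_ideal], [BLip_ideal_norm_le]).  Everything about N
    thus becomes an operation on unit factorizations.

    - Sums ([unit_factorizationD]).  If T = A o (f1, f2) and U = B o (g1, g2)
      with constants r and s, let G_j x H_j carry the max norm and take
      h_j = (f_j, g_j) / 2.  By the ideal property applied to the two
      isometric inclusions of the factors, h_j lies in the ideal and
      ||h_j|| <= (1 + 1) / 2.  Then T + U = C o (h1, h2) with
      C(u, v) = A(2 u.1, 2 v.1) + B(2 u.2, 2 v.2), whose constant is
      2 * 2 * (r + s).  This is where the quasi-norm constant 4 comes from.
    - Scalars ([unit_factorizationZ]).  Multiply A by the scalar; homogeneity
      of N follows from the inequality N(a T) <= |a| N(T) used for a and for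
      its inverse.
    - Definiteness ([unit_factorization_rnorm]).  Since Lip(f_j) <= ||f_j||, a
      unit factorization with constant r gives
      |T(x, y)| <= r d(x, 0) d(y, 0); if N(T) = 0 this holds for all r > 0.

    The max-norm product of two Banach spaces must itself be a Banach space,
    which is [prod_complete]. *)

Set Implicit Arguments.
Unset Strict Implicit.
Unset Printing Implicit Defensive.

Local Open Scope classical_set_scope.
Local Open Scope ring_scope.

(** * Real-valued norms over the real or complex scalars *)

Section RealNorm.
Context {R : realType} {k : scalar_kind}.
Implicit Types (a b : scalars R k) (r s : R).

Lemma real_part0 : real_part (0 : scalars R k) = 0.
Proof. by case: k. Qed.

Lemma real_part_ge0 a : 0 <= a -> 0 <= real_part a.
Proof. by move=> /real_part_le; rewrite real_part0. Qed.

Lemma real_partM a b : 0 <= a -> real_part (a * b) = real_part a * real_part b.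
Proof.
case: k a b => //= -[ar ai] [br bi]; rewrite lecE /= => /andP[/eqP -> _].
by rewrite mul0r subr0.
Qed.

Lemma real_part_norm_eq0 a : real_part `|a| = 0 -> a = 0.
Proof. by move=> /(real_part_eq0 (normr_ge0 a))/normr0_eq0. Qed.

Lemma real_part_normV a : real_part `|a^-1| = (real_part `|a|)^-1.
Proof.
have [->|a0] := eqVneq a 0.
  by rewrite invr0 normr0 real_part0 invr0.
have na0 : real_part `|a| != 0 by apply: contra_neq a0 => /real_part_norm_eq0.
apply: (mulfI na0); rewrite divff // -real_partM // -normrM divff // normr1.
by case: (k).
Qed.

Definition real_scalar r : scalars R k :=
  match k with RealScalars => r | ComplexScalars => r%:C%C end.

Lemma real_scalar_norm r : 0 <= r -> real_part `|real_scalar r| = r.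
Proof.
rewrite /real_scalar; case: (k) => /= r0; first exact: ger0_norm.
by rewrite expr0n addr0 sqrtr_sqr ger0_norm.
Qed.

Lemma real_scalarK r : r != 0 -> real_scalar r * real_scalar r^-1 = 1.
Proof.
move=> r0; rewrite /real_scalar; case: (k) => /=; first exact: divff.
by rewrite -[LHS](rmorphM (real_complex R)) divff.
Qed.

End RealNorm.

Section RNorm.
Context {R : realType} {k : scalar_kind} {V W : normedModType (scalars R k)}.
Implicit Types (a : scalars R k) (x : V).

Lemma rnorm_ge0 x : 0 <= rnorm x.
Proof. exact: real_part_ge0. Qed.

Lemma rnormZ a x : rnorm (a *: x) = real_part `|a| * rnorm x.
Proof. by rewrite /rnorm normrZ real_partM. Qed.

Lemma rnorm_fst (z : V * W) : rnorm z.1 <= rnorm z.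
Proof.
apply: real_part_le; rewrite [leRHS]prod_normE /=.
by rewrite num_le_max ?lexx // realE ?normr_ge0.
Qed.

Lemma rnorm_snd (z : V * W) : rnorm z.2 <= rnorm z.
Proof.
apply: real_part_le; rewrite [leRHS]prod_normE /=.
by rewrite num_le_max ?lexx ?orbT // realE ?normr_ge0.
Qed.

Lemma rnorm_inl x : rnorm (x, 0 : W) = rnorm x.
Proof.
by rewrite /rnorm prod_normE /= normr0 max_l.
Qed.

Lemma rnorm_inr (y : W) : rnorm (0 : V, y) = rnorm y.
Proof.
by rewrite /rnorm prod_normE /= normr0 max_r.
Qed.

Definition prod_inl (x : V) : V * W := (x, 0).

Lemma prod_inl_is_linear : linear prod_inl.
Proof.
by move=> a x y; apply: injective_projections; rewrite /= ?scaler0 ?addr0.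
Qed.

HB.instance Definition _ :=
  GRing.isLinear.Build _ _ _ _ prod_inl prod_inl_is_linear.

Definition prod_inr (y : W) : V * W := (0, y).

Lemma prod_inr_is_linear : linear prod_inr.
Proof.
by move=> a x y; apply: injective_projections; rewrite /= ?scaler0 ?addr0.
Qed.

HB.instance Definition _ :=
  GRing.isLinear.Build _ _ _ _ prod_inr prod_inr_is_linear.

End RNorm.

(** * Completeness of products *)

(* Declares the product of two pointed uniform spaces as pointed and uniform,
   a join of structures needed to speak of its completeness. *)
HB.saturate prod.

(** Both projections are uniformly continuous, so they send a Cauchy filter to
    Cauchy filters; the limits of these are the coordinates of its limit. *)
Lemma prod_complete (K : numFieldType)
    (U V : completeNormedModType K) (F : set_system (U * V)) :
  ProperFilter F -> cauchy F -> cvg F.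
Proof.
move=> FF Fc.
have cvg_image (T : completeType) (p : U * V -> T) :
    (forall A, entourage A -> entourage [set z | A (p z.1, p z.2)]) ->
    cvg (p @ F).
  move=> p_unif; apply: cauchy_cvg => A /p_unif/Fc[[P Q] /= [FP FQ] PQ].
  exists (p @` P, p @` Q) => /=.
    by split; [apply: filterS FP|apply: filterS FQ] => z ? /=; exists z.
  by move=> [_ _] /= [[z Pz <-] [w Qw <-]]; exact: (PQ (z, w)).
have fst_unif A : entourage A ->
    entourage [set z : (U * V) * (U * V) | A (z.1.1, z.2.1)].
  move=> entA; exists (A, setT); first by split => //; exact: entourageT.
  by move=> [[u u'] [v v']] /= [Aw _]; exists (u, v, (u', v')).
have snd_unif A : entourage A ->
    entourage [set z : (U * V) * (U * V) | A (z.1.2, z.2.2)].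
  move=> entA; exists (setT, A); first by split => //; exact: entourageT.
  by move=> [[u u'] [v v']] /= [_ Aw]; exists (u, v, (u', v')).
have /cvg_ex[/= u Fu] := cvg_image _ _ fst_unif.
have /cvg_ex[/= v Fv] := cvg_image _ _ snd_unif.
apply/cvg_ex; exists (u, v).
apply: cvg_trans (cvg_pair Fu Fv) => A /= FA.
suff -> : A = [set z | A (z.1, z.2)] by [].
by apply/funext => -[].
Qed.

HB.instance Definition _ (K : numFieldType)
    (U V : completeNormedModType K) :=
  Uniform_isComplete.Build (U * V)%type (@prod_complete K U V).

(** * Lipschitz constants *)

Section LipschitzConstants.
Context {R : realType}.

(** Covers the empty set too, whose infimum is 0 by convention. *)
Lemma inf_ge0 (A : set R) : (forall x, A x -> 0 <= x) -> 0 <= inf A.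
Proof.
move=> A0; have [->|/set0P An0] := eqVneq A set0; first by rewrite inf0.
exact: lb_le_inf.
Qed.

Lemma Lip_le {X Y : pointedMetricType R} {T : X -> Y} {C : R} :
  lip_bound T C -> Lip T <= C.
Proof. by apply: ge_inf; exists 0 => C' []. Qed.

(** The infimum defining Lip(T) is attained: at distinct points the constants
    are exactly the upper bounds of a quotient of distances. *)
Lemma lip_bound_Lip {X Y : pointedMetricType R} {T : X -> Y} :
  Lip0 X Y T -> lip_bound T (Lip T).
Proof.
move=> [[C TC] _]; split; first by apply: lb_le_inf; [exists C|move=> C' []].
move=> x y; have := mdist_ge0 x y; rewrite le0r => /orP[/eqP xy0|xy_gt0].
  by have := TC.2 x y; rewrite xy0 !mulr0.
rewrite -ler_pdivrMr //; apply: lb_le_inf; first by exists C.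
by move=> C' [_ TC']; rewrite ler_pdivrMr.
Qed.

Lemma Lip0_id (X : pointedMetricType R) : Lip0 X X id.
Proof. by split => //; exists 1; split => // x y; rewrite mul1r. Qed.

Lemma Lip_id_le1 (X : pointedMetricType R) : Lip (@id X) <= 1.
Proof. by apply: Lip_le; split => // x y; rewrite mul1r. Qed.

End LipschitzConstants.

(** * Two-Lipschitz maps *)

Section TwoLipschitz.
Context {R : realType} {k : scalar_kind}.
Local Notation K := (scalars R k).
Context {X1 X2 : pointedMetricType R} {E : completeNormedModType K}.
Implicit Types (T A B : X1 * X2 -> E) (C D : R).

Lemma BLip_ge0 T : 0 <= BLip T.
Proof. by apply: inf_ge0 => C [/ltW]. Qed.

Lemma BLip_le {T C} : blip_bound T C -> BLip T <= C.
Proof. by apply: ge_inf; exists 0 => C' [/ltW]. Qed.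

Lemma blip_boundD {A B C D} :
  blip_bound A C -> blip_bound B D -> blip_bound (A + B) (C + D).
Proof.
move=> [C0 AC] [D0 BD]; split=> [|x x' y y']; first exact: addr_gt0.
rewrite !mulrDl; apply: le_trans (lerD (AC x x' y y') (BD x x' y y')).
apply: le_trans (rnormD _ _).
rewrite !fctE !opprD (addrACA (A (x, y))).
by rewrite (addrACA (A (x, y) - _)) (addrACA (A (x, y) - _ - _)).
Qed.

Lemma blip_boundZ {a : K} {A C D} :
  0 < D -> real_part `|a| * C <= D -> blip_bound A C -> blip_bound (a *: A) D.
Proof.
move=> D0 aCD [C0 AC]; split=> // x x' y y'.
rewrite !fctE -!scalerBr -scalerDr rnormZ.
apply: le_trans (ler_wpM2l (real_part_ge0 (normr_ge0 a)) (AC x x' y y')) _.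
by rewrite !mulrA !ler_wpM2r ?mdist_ge0.
Qed.

Lemma blip_bound_precomp {Y1 Y2 : pointedMetricType R} {S1 : Y1 -> X1}
    {S2 : Y2 -> X2} {c1 c2 : R} {A C D} :
    0 < D -> C * c1 * c2 <= D -> lip_bound S1 c1 -> lip_bound S2 c2 ->
  blip_bound A C -> blip_bound (fun y => A (S1 y.1, S2 y.2)) D.
Proof.
move=> D0 CD [c10 S1c] [c20 S2c] [C0 AC]; split=> //= x x' y y'.
apply: le_trans (AC _ _ _ _) _.
apply: (@le_trans _ _ (C * (c1 * mdist x x') * (c2 * mdist y y'))).
  apply: ler_pM; rewrite ?mulr_ge0 ?mdist_ge0 ?(ltW C0) //.
  by rewrite ler_wpM2l ?(ltW C0).
have -> : C * (c1 * mdist x x') * (c2 * mdist y y') =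
  C * c1 * c2 * mdist x x' * mdist y y' by ring.
by rewrite !ler_wpM2r ?mdist_ge0.
Qed.

Lemma BLip0D {A B} :
  BLip0 X1 X2 E A -> BLip0 X1 X2 E B -> BLip0 X1 X2 E (A + B).
Proof.
move=> [A1 A2 [C AC]] [B1 B2 [D BD]]; split.
- by move=> x; rewrite fctE A1 B1 addr0.
- by move=> x; rewrite fctE A2 B2 addr0.
- by exists (C + D); exact: blip_boundD.
Qed.

Lemma BLip0Z (a : K) {A} : BLip0 X1 X2 E A -> BLip0 X1 X2 E (a *: A).
Proof.
move=> [A1 A2 [C AC]]; split.
- by move=> x; rewrite fctE A1 scaler0.
- by move=> x; rewrite fctE A2 scaler0.
- have aC : 0 <= real_part `|a| * C.
    by rewrite mulr_ge0 ?real_part_ge0 ?(ltW AC.1).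
  (* The added 1 keeps the constant positive when a = 0. *)
  exists (real_part `|a| * C + 1); apply: blip_boundZ AC; first exact: ltr_wpDl.
  by rewrite lerDl.
Qed.

Lemma BLip0_precomp {Y1 Y2 : pointedMetricType R} {S1 : Y1 -> X1}
    {S2 : Y2 -> X2} {A} :
    Lip0 Y1 X1 S1 -> Lip0 Y2 X2 S2 ->
  BLip0 X1 X2 E A -> BLip0 Y1 Y2 E (fun y => A (S1 y.1, S2 y.2)).
Proof.
move=> [[c1 S1c] S10] [[c2 S2c] S20] [A1 A2 [C AC]]; split=> /=.
- by move=> y; rewrite S20 A1.
- by move=> y; rewrite S10 A2.
- have Cc : 0 <= C * c1 * c2 by rewrite !mulr_ge0 ?(ltW AC.1) ?S1c.1 ?S2c.1.
  (* The added 1 keeps the constant positive when c1 or c2 vanishes. *)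
  exists (C * c1 * c2 + 1); apply: blip_bound_precomp S1c S2c AC.
    exact: ltr_wpDl.
  by rewrite lerDl.
Qed.

(** The mixed difference based at the base points is the value itself, because
    A vanishes on both axes. *)
Lemma blip_bound_rnorm {A C} x y : BLip0 X1 X2 E A -> blip_bound A C ->
  rnorm (A (x, y)) <= C * mdist x point * mdist y point.
Proof.
move=> [A1 A2 _] [_ /(_ x point y point)].
by rewrite !A1 A2 !subr0 addr0.
Qed.

End TwoLipschitz.

(** * Members of a normed Lipschitz ideal *)

Section IdealMembers.
Context {R : realType} {k : scalar_kind} (I : normed_lipschitz_ideal R k).
Context {X : pointedMetricType R}.
Local Notation K := (scalars R k).

Lemma ideal_Lip0 {G : completeNormedModType K} {f : X -> G} :
  ideal_set I f -> Lip0 X (banach_metric G) f.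
Proof. by have [+ _ _] := ideal_subspace I X G; exact. Qed.

Lemma ideal_norm_ge0 {G : completeNormedModType K} {f : X -> G} :
  ideal_set I f -> 0 <= ideal_norm I f.
Proof. by have [+ _ _ _] := ideal_norm_norm I X G; exact. Qed.

Lemma ideal_lip_bound {G : completeNormedModType K} {f : X -> G} :
  ideal_set I f -> lip_bound (f : X -> banach_metric G) (ideal_norm I f).
Proof.
move=> If; have [L0 fL] := lip_bound_Lip (ideal_Lip0 If).
split=> [|x y]; first exact: ideal_norm_ge0.
by apply: le_trans (fL x y) _; rewrite ler_wpM2r ?mdist_ge0 ?Lip_le_ideal_norm.
Qed.

(** The ideal property with the identity of X on the right, whose Lipschitz
    constant is at most 1 (and 0 when X is a single point). *)
Lemma ideal_postcomp {G H : completeNormedModType K} {f : X -> G}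
    (w : {linear G -> H}) : op_bound w 1 -> ideal_set I f ->
  ideal_set I (w \o f) /\ ideal_norm I (w \o f) <= ideal_norm I f.
Proof.
move=> w1 If; have wb : bounded_op w by exists 1.
split; first exact: (ideal_comp (Lip0_id X) If wb).
apply: le_trans (ideal_norm_comp (Lip0_id X) If wb) _.
have f0 := ideal_norm_ge0 If.
have nw0 : 0 <= op_norm w by apply: inf_ge0 => C [].
have nw1 : op_norm w <= 1 by apply: ge_inf => //; exists 0 => C [].
rewrite -[leRHS]mulr1; apply: ler_pM => //.
  by rewrite mulr_ge0 // (lip_bound_Lip (Lip0_id X)).1.
by rewrite -[leRHS]mul1r ler_wpM2r // Lip_id_le1.
Qed.

Lemma ideal_setZ {G : completeNormedModType K} (a : K) {f : X -> G} :
  ideal_set I f -> ideal_set I (a *: f) /\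
    ideal_norm I (a *: f) = real_part `|a| * ideal_norm I f.
Proof.
move=> If; have [_ I0 IZD] := ideal_subspace I X G.
have [_ _ nZ _] := ideal_norm_norm I X G.
by split; [rewrite -[_ *: _]addr0; exact: IZD|exact: nZ].
Qed.

(** The pair is the sum of f and g, each followed by the inclusion of its
    target in the product. *)
Lemma ideal_pair {G H : completeNormedModType K} {f : X -> G} {g : X -> H} :
  ideal_set I f -> ideal_set I g ->
  ideal_set I (fun x => (f x, g x) : (G * H)%type) /\
  ideal_norm I (fun x => (f x, g x) : (G * H)%type) <=
    ideal_norm I f + ideal_norm I g.
Proof.
move=> If Ig.
have inl1 : op_bound (@prod_inl R k G H) 1.
  by split => // u; rewrite mul1r rnorm_inl.
have inr1 : op_bound (@prod_inr R k G H) 1.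
  by split => // u; rewrite mul1r rnorm_inr.
have [Ilf nlf] := ideal_postcomp inl1 If.
have [Irg nrg] := ideal_postcomp inr1 Ig.
have -> : (fun x => (f x, g x) : (G * H)%type) =
    1 *: (@prod_inl R k G H \o f) + (@prod_inr R k G H \o g).
  apply/funext => x; rewrite scale1r fctE.
  by apply: injective_projections; rewrite /= ?addr0 ?add0r.
have [_ _ IZD] := ideal_subspace I X (G * H)%type.
have [_ _ _ nD] := ideal_norm_norm I X (G * H)%type.
split; first exact: IZD.
rewrite scale1r; apply: le_trans (nD _ _ Ilf Irg) _.
by rewrite mul1r lerD.
Qed.

End IdealMembers.

(** * Dilations between Banach spaces *)

Section BanachMetricMaps.
Context {R : realType} {k : scalar_kind}.
Context {G H : completeNormedModType (scalars R k)}.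
Implicit Types (c : R).

Definition dilation c (u : banach_metric G) : banach_metric G :=
  real_scalar c *: (u : G).

Definition dilation_fst c (u : banach_metric (G * H)%type) : banach_metric G :=
  dilation c (u : G * H).1.

Definition dilation_snd c (u : banach_metric (H * G)%type) : banach_metric G :=
  dilation c (u : H * G).2.

Lemma dilation_lip {c} : 0 <= c -> lip_bound (dilation c) c.
Proof.
move=> c0; split => // u v; rewrite /mdist /=.
by rewrite -scalerBr rnormZ real_scalar_norm.
Qed.

Lemma dilation_fst_lip {c} : 0 <= c -> lip_bound (dilation_fst c) c.
Proof.
move=> c0; split => // u v; apply: le_trans ((dilation_lip c0).2 _ _) _.
by rewrite ler_wpM2l //; exact: (rnorm_fst ((u : G * H) - v)).
Qed.

Lemma dilation_snd_lip {c} : 0 <= c -> lip_bound (dilation_snd c) c.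
Proof.
move=> c0; split => // u v; apply: le_trans ((dilation_lip c0).2 _ _) _.
by rewrite ler_wpM2l //; exact: (rnorm_snd ((u : H * G) - v)).
Qed.

Lemma dilation_Lip0 {c} : 0 <= c -> Lip0 _ _ (dilation c).
Proof.
by move=> c0; split; [exists c; exact: dilation_lip|exact: scaler0].
Qed.

Lemma dilation_fst_Lip0 {c} : 0 <= c -> Lip0 _ _ (dilation_fst c).
Proof.
by move=> c0; split; [exists c; exact: dilation_fst_lip|exact: scaler0].
Qed.

Lemma dilation_snd_Lip0 {c} : 0 <= c -> Lip0 _ _ (dilation_snd c).
Proof.
by move=> c0; split; [exists c; exact: dilation_snd_lip|exact: scaler0].
Qed.

End BanachMetricMaps.

(** * Unit factorizations *)

Section Factorization.
Context {R : realType} {k : scalar_kind} (I1 I2 : normed_lipschitz_ideal R k).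
Context {X1 X2 : pointedMetricType R} {E : completeNormedModType (scalars R k)}.
Local Notation K := (scalars R k).
Local Notation N := (BLip_ideal_norm I1 I2 X1 X2 E).
Implicit Types (T : X1 * X2 -> E) (r s : R).

(** Factorizations through the unit balls of the two ideals: all of the size of
    T is carried by the two-Lipschitz constant r of A. *)
Definition unit_factorization T r :=
  exists (G1 G2 : completeNormedModType K) (f1 : X1 -> G1) (f2 : X2 -> G2)
    (A : banach_metric G1 * banach_metric G2 -> E),
  [/\ factorization I1 I2 T f1 f2 A, ideal_norm I1 f1 <= 1,
      ideal_norm I2 f2 <= 1 & blip_bound A r].

Lemma factorization_BLip_ideal {T} {G1 G2 : completeNormedModType K}
    {f1 : X1 -> G1} {f2 : X2 -> G2}
    {A : banach_metric G1 * banach_metric G2 -> E} :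
  factorization I1 I2 T f1 f2 A -> BLip_ideal I1 I2 X1 X2 E T.
Proof.
move=> Tf; split; last by exists G1, G2, f1, f2, A.
have [If1 If2 A0 ->] := Tf.
exact: (BLip0_precomp (ideal_Lip0 If1) (ideal_Lip0 If2) A0).
Qed.

Lemma unit_factorization_ideal {T r} :
  unit_factorization T r -> BLip_ideal I1 I2 X1 X2 E T.
Proof. by move=> [G1 [G2 [f1 [f2 [A [/factorization_BLip_ideal]]]]]]. Qed.

Lemma BLip_ideal_norm_ge0 T : 0 <= N T.
Proof.
apply: inf_ge0 => _ [G1 [G2 [f1 [f2 [A [[If1 If2 _ _] ->]]]]]].
by rewrite !mulr_ge0 ?BLip_ge0 ?ideal_norm_ge0.
Qed.

Lemma BLip_ideal_norm_le {T r} : unit_factorization T r -> N T <= r.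
Proof.
move=> [G1 [G2 [f1 [f2 [A [Tf n1 n2 Ar]]]]]]; have [If1 If2 A0 _] := Tf.
apply: (@le_trans _ _ (BLip A * ideal_norm I1 f1 * ideal_norm I2 f2)).
  apply: ge_inf; last by exists G1, G2, f1, f2, A.
  exists 0 => _ [G1' [G2' [g1 [g2 [B [[Ig1 Ig2 _ _] ->]]]]]].
  by rewrite !mulr_ge0 ?BLip_ge0 ?ideal_norm_ge0.
have [f1_ge0 f2_ge0] := (ideal_norm_ge0 If1, ideal_norm_ge0 If2).
rewrite -[leRHS]mulr1; apply: ler_pM; rewrite ?mulr_ge0 ?BLip_ge0 //.
by rewrite -[leRHS]mulr1; apply: ler_pM; rewrite ?BLip_ge0 ?BLip_le.
Qed.

(** A member of the unit ball of an ideal is 1-Lipschitz and fixes the base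
    point, so it does not increase the distance to the base point. *)
Lemma unit_factorization_rnorm {T r} x y : unit_factorization T r ->
  rnorm (T (x, y)) <= r * mdist x point * mdist y point.
Proof.
move=> [G1 [G2 [f1 [f2 [A [[If1 If2 A0 ->] n1 n2 Ar]]]]]] /=.
have [_ f10] := ideal_Lip0 If1; have [_ f20] := ideal_Lip0 If2.
apply: le_trans
  (blip_bound_rnorm (f1 x : banach_metric G1) (f2 y : banach_metric G2)
     A0 Ar) _.
have [f1l f2l] := (ideal_lip_bound If1, ideal_lip_bound If2).
rewrite -f10 -f20; apply: ler_pM; rewrite ?mulr_ge0 ?mdist_ge0 ?(ltW Ar.1) //.
  rewrite ler_wpM2l ?(ltW Ar.1) //; apply: le_trans (f1l.2 _ _) _.
  by rewrite -[leRHS]mul1r ler_wpM2r ?mdist_ge0.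
apply: le_trans (f2l.2 _ _) _.
by rewrite -[leRHS]mul1r ler_wpM2r ?mdist_ge0.
Qed.

(** The zero maps into the scalar field serve, with a positive constant as
    small as desired. *)
Lemma unit_factorization0 r : 0 < r -> unit_factorization 0 r.
Proof.
move=> r0; pose G := scalar_space R k : completeNormedModType K.
have ideal0 (I : normed_lipschitz_ideal R k) (X : pointedMetricType R) :
    ideal_set I (0 : X -> G) /\ ideal_norm I (0 : X -> G) = 0.
  have [_ I0 _] := ideal_subspace I X G.
  by have [_ n0 _ _] := ideal_norm_norm I X G; split=> //; exact/n0.
have [I10 n10] := ideal0 I1 X1; have [I20 n20] := ideal0 I2 X2.
have bound0 : blip_bound (0 : banach_metric G * banach_metric G -> E) r.
  split => // x x' y y'.
  have zero z : (0 : banach_metric G * banach_metric G -> E) z = 0 by [].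
  by rewrite !zero !subr0 addr0 rnorm0 !mulr_ge0 ?mdist_ge0 ?ltW.
exists G, G, 0, 0, 0; rewrite n10 n20; split => //; split => //.
by split => //; exists r.
Qed.

Lemma unit_factorizationZ {a : K} {T r s} : 0 < s -> real_part `|a| * r <= s ->
  unit_factorization T r -> unit_factorization (a *: T) s.
Proof.
move=> s0 ars [G1 [G2 [f1 [f2 [A [[If1 If2 A0 ->] n1 n2 Ar]]]]]].
exists G1, G2, f1, f2, (a *: A); split=> //; last exact: blip_boundZ Ar.
by split => //; exact: BLip0Z.
Qed.

(** Halving the pairs (f_j, g_j) keeps them in the unit balls; undoing this by
    a dilation of factor 2 in each variable costs the factor 4. *)
Lemma unit_factorizationD {T U : X1 * X2 -> E} {r s} :
    unit_factorization T r -> unit_factorization U s ->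
  unit_factorization (T + U) (4 * (r + s)).
Proof.
move=> [G1 [G2 [f1 [f2 [A [[If1 If2 A0 ->] nf1 nf2 Ar]]]]]].
move=> [H1 [H2 [g1 [g2 [B [[Ig1 Ig2 B0 ->] ng1 ng2 Bs]]]]]].
have half_pair (I : normed_lipschitz_ideal R k) (X : pointedMetricType R)
    (G H : completeNormedModType K) (f : X -> G) (g : X -> H) :
    ideal_set I f -> ideal_set I g ->
    ideal_norm I f <= 1 -> ideal_norm I g <= 1 ->
    let h := real_scalar 2^-1 *: (fun x => (f x, g x) : (G * H)%type) in
    ideal_set I h /\ ideal_norm I h <= 1.
  move=> If Ig nf ng h; have [Ip np] := ideal_pair If Ig.
  have [Ih ->] := ideal_setZ (real_scalar 2^-1) Ip; split => //.
  rewrite real_scalar_norm ?invr_ge0 // ler_pdivrMl //; lra.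
have [Ih1 nh1] := half_pair _ _ _ _ _ _ If1 Ig1 nf1 ng1.
have [Ih2 nh2] := half_pair _ _ _ _ _ _ If2 Ig2 nf2 ng2.
have two_ge0 : 0 <= 2 :> R by [].
pose A' (z : banach_metric (G1 * H1)%type * banach_metric (G2 * H2)%type) : E :=
  A (dilation_fst 2 z.1, dilation_fst 2 z.2).
pose B' (z : banach_metric (G1 * H1)%type * banach_metric (G2 * H2)%type) : E :=
  B (dilation_snd 2 z.1, dilation_snd 2 z.2).
have A'0 : BLip0 _ _ E A'.
  exact: BLip0_precomp (dilation_fst_Lip0 two_ge0)
    (dilation_fst_Lip0 two_ge0) A0.
have B'0 : BLip0 _ _ E B'.
  exact: BLip0_precomp (dilation_snd_Lip0 two_ge0)
    (dilation_snd_Lip0 two_ge0) B0.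
exists (G1 * H1)%type, (G2 * H2)%type.
exists (real_scalar 2^-1 *: (fun x => (f1 x, g1 x) : (G1 * H1)%type)).
exists (real_scalar 2^-1 *: (fun x => (f2 x, g2 x) : (G2 * H2)%type)).
exists (A' + B'); split => //.
- split => //; first exact: BLip0D.
  apply/funext => -[x y]; rewrite !fctE /A' /B' /dilation_fst /dilation_snd.
  rewrite /dilation /=.
  by rewrite !scalerA !real_scalarK // !scale1r.
- have [[r_gt0 _] [s_gt0 _]] := (Ar, Bs).
  rewrite mulrDr; apply: blip_boundD.
  + apply: blip_bound_precomp (dilation_fst_lip two_ge0)
      (dilation_fst_lip two_ge0) Ar; lra.
  + apply: blip_bound_precomp (dilation_snd_lip two_ge0)
      (dilation_snd_lip two_ge0) Bs; lra.
Qed.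

(** Moves the ideal norms of f1 and f2 into A by dilations.  When one of them
    is zero, that f_j is zero and so is T, since A vanishes on the axes. *)
Lemma unit_factorization_norm_lt {T r} :
  BLip_ideal I1 I2 X1 X2 E T -> N T < r -> unit_factorization T r.
Proof.
move=> [T0 [G1' [G2' [f1' [f2' [A' Tf']]]]]] NTr.
have r0 : 0 < r := le_lt_trans (BLip_ideal_norm_ge0 T) NTr.
have [|_ [G1 [G2 [f1 [f2 [A [[If1 If2 A0 defT] ->]]]]]] ltr] := inf_lt _ NTr.
  exists (BLip A' * ideal_norm I1 f1' * ideal_norm I2 f2').
  by exists G1', G2', f1', f2', A'.
have [A1 A2 [C AC]] := A0.
have [n1_0|n1_neq0] := eqVneq (ideal_norm I1 f1) 0.
  have [_ /(_ _ If1)[/(_ n1_0) f1_0 _] _ _] := ideal_norm_norm I1 X1 G1.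
  suff -> : T = 0 by exact: unit_factorization0.
  by rewrite defT f1_0; apply/funext => x; exact: A2.
have [n2_0|n2_neq0] := eqVneq (ideal_norm I2 f2) 0.
  have [_ /(_ _ If2)[/(_ n2_0) f2_0 _] _ _] := ideal_norm_norm I2 X2 G2.
  suff -> : T = 0 by exact: unit_factorization0.
  by rewrite defT f2_0; apply/funext => x; exact: A1.
move: (ideal_norm_ge0 If1) (ideal_norm_ge0 If2) n1_neq0 n2_neq0 ltr.
set n1 := ideal_norm I1 f1; set n2 := ideal_norm I2 f2.
move=> n1_ge0 n2_ge0 n1_neq0 n2_neq0.
have n1_gt0 : 0 < n1 by rewrite lt_def n1_neq0.
have n2_gt0 : 0 < n2 by rewrite lt_def n2_neq0.
(* BLip(A) is an infimum: replace it by an admissible constant D that still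
   satisfies D n1 n2 < r. *)
rewrite -mulrA -ltr_pdivlMr ?mulr_gt0 // => /inf_lt[|D AD].
  by exists C.
rewrite ltr_pdivlMr ?mulr_gt0 // => /ltW Dr.
have [[Ih1 nh1] [Ih2 nh2]] :=
  (ideal_setZ (real_scalar n1^-1) If1, ideal_setZ (real_scalar n2^-1) If2).
exists G1, G2, (real_scalar n1^-1 *: f1), (real_scalar n2^-1 *: f2).
exists (fun z => A (dilation n1 z.1, dilation n2 z.2)); split.
- split => //.
    by exact: BLip0_precomp (dilation_Lip0 n1_ge0) (dilation_Lip0 n2_ge0) A0.
  rewrite defT; apply/funext => -[x y]; rewrite !fctE /dilation /=.
  by rewrite !scalerA !real_scalarK // !scale1r.
- by rewrite nh1 real_scalar_norm ?invr_ge0 // mulVf.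
- by rewrite nh2 real_scalar_norm ?invr_ge0 // mulVf.
- by apply: blip_bound_precomp (dilation_lip n1_ge0) (dilation_lip n2_ge0) AD;
    rewrite -?mulrA.
Qed.

End Factorization.

(** * The quasi-normed space of factorable two-Lipschitz maps *)

Theorem proposition5p11 (R : realType) (k : scalar_kind)
    (I1 I2 : normed_lipschitz_ideal R k) (X1 X2 : pointedMetricType R)
    (E : completeNormedModType (scalars R k)) :
  linear_subspace (BLip0 X1 X2 E) (BLip_ideal I1 I2 X1 X2 E) /\
  is_quasi_norm (BLip_ideal I1 I2 X1 X2 E) (BLip_ideal_norm I1 I2 X1 X2 E).
Proof.
set B := BLip_ideal I1 I2 X1 X2 E; set N := BLip_ideal_norm I1 I2 X1 X2 E.
have fact T : B T -> unit_factorization I1 I2 T (N T + 1).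
  by move=> BT; apply: unit_factorization_norm_lt => //; rewrite ltrDl.
have N_ge0 T : 0 <= N T by exact: BLip_ideal_norm_ge0.
have N0 : N 0 = 0.
  apply/eqP; rewrite eq_le N_ge0 andbT; apply/ler_addgt0Pr => e e0.
  by rewrite add0r; exact/BLip_ideal_norm_le/unit_factorization0.
have BZ a T : B T -> B (a *: T).
  move=> /fact BT.
  have aN_ge0 : 0 <= real_part `|a| * (N T + 1).
    by rewrite mulr_ge0 ?real_part_ge0 ?addr_ge0.
  apply: unit_factorization_ideal.
  apply: (unit_factorizationZ (ltr_wpDl aN_ge0 ltr01) _ BT).
  by rewrite lerDl.
have NZ_le a T : B T -> N (a *: T) <= real_part `|a| * N T.
  move=> BT; apply/ler_addgt0Pr => e e0.
  have a_ge0 : 0 <= real_part `|a| by exact: real_part_ge0.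
  (* Dividing by |a| + 1 instead of |a| also covers a = 0. *)
  pose d := e / (real_part `|a| + 1).
  have d_gt0 : 0 < d by rewrite divr_gt0 // ltr_wpDl.
  apply: BLip_ideal_norm_le; apply: unit_factorizationZ; last first.
  - by apply: (unit_factorization_norm_lt (r := N T + d) BT); rewrite ltrDl.
  - rewrite mulrDr lerD2l mulrCA ger_pMr // ler_pdivrMr ?ltr_wpDl //.
    by rewrite mul1r lerDl.
  - by rewrite ltr_wpDl ?mulr_ge0.
split.
  split; first by move=> T [].
  - exact: unit_factorization_ideal (unit_factorization0 _ _ ltr01).
  - move=> a T U /(BZ a)/fact fT /fact fU.
    exact: unit_factorization_ideal (unit_factorizationD fT fU).
(* The constant of the sum of two unit factorizations. *)
exists 4; split; first by rewrite ler1n.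
split => //.
- move=> T BT; split => [NT0|->//]; apply/funext => -[x y].
  apply: (@rnorm0_eq0 R k E); apply/eqP; rewrite eq_le rnorm_ge0 andbT.
  set d := mdist x point * mdist y point.
  have d_ge0 : 0 <= d by rewrite mulr_ge0 ?mdist_ge0.
  apply/ler_addgt0Pr => e e0; rewrite add0r.
  (* Adding 1 to d avoids a case distinction for d = 0. *)
  have r0 : 0 < e / (d + 1) by rewrite divr_gt0 // ltr_wpDl.
  have fT : unit_factorization I1 I2 T (e / (d + 1)).
    by apply: unit_factorization_norm_lt => //; rewrite -/N NT0.
  apply: le_trans (unit_factorization_rnorm x y fT) _.
  rewrite -mulrA -/d mulrAC ler_pdivrMr ?ltr_wpDl //.
  by rewrite ler_wpM2l ?(ltW e0) // lerDl.
- move=> a T BT; apply/eqP; rewrite eq_le NZ_le //=.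
  have [->|a0] := eqVneq a 0.
    by rewrite normr0 real_part0 mul0r.
  have a_gt0 : 0 < real_part `|a|.
    rewrite lt_def real_part_ge0 // andbT.
    by apply: contra_neq a0 => /real_part_norm_eq0.
  rewrite -ler_pdivlMl // -real_part_normV.
  by rewrite -[in leLHS](scalerK a0 T) NZ_le //; exact: BZ.
- move=> T U BT BU; apply/ler_addgt0Pr => e e0.
  have -> : 4 * (N T + N U) + e = 4 * ((N T + e / 8) + (N U + e / 8)) by lra.
  by apply/BLip_ideal_norm_le/unit_factorizationD;
    apply: unit_factorization_norm_lt; rewrite // ltrDl divr_gt0.
Qed.
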